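(* Let $d\ge2$ be an integer, $q>0$, $1<p\le\infty$ and $p'=p/(p-1)$ (with $p'=1$ if $p=\infty$). For $s>0$ let $L_s$ be the operator $$(L_su)(t)=\frac1d\sum_{i=0}^{d-1}\left|\cos\left(\pi\frac{t+i}{d}\right)\right|^su\left(\frac{t+i}{d}\right).$$ Let $\rho_p(L_q)=\lim_{n\to\infty}\|L_q^n\|_{p\to p}^{1/n}$ be the spectral radius of $L_q$ as an operator on $L^p(\mathbb{T})$, and let $\rho(L_{qp'})$ be the spectral radius of $L_{qp'}$ as an operator on $C(\mathbb{T})$. Then $$\rho_p(L_q)=\left[\rho(L_{qp'})\right]^{1/p'}.$$
   Context: $\mathbb{T}=\mathbb{R}/\mathbb{Z}$ is identified with $[0,1]$ with $0$ and $1$ identified, with Lebesgue measure. $C(\mathbb{T})$ is the Banach space of continuous complex-valued functions on $\mathbb{T}$ with the maximum norm. $\|\cdot\|_{p\to p}$ denotes the operator norm on $L^p(\mathbb{T})$. In the formula for $L_su$, the argument $t$ is taken in $[0,1)$. If the weight is even-powered or $d$ is odd/even this makes no difference: functions of $\frac{t+i}{d}$ are regarded as $1$-periodic. *)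

(* Defs.v *)
From HB Require Import structures.
From mathcomp Require Import all_boot all_order all_algebra.
From mathcomp Require Import complex.
From mathcomp Require Import all_classical all_reals all_analysis.
Import Order.TTheory GRing.Theory Num.Theory.
Import numFieldNormedType.Exports.

Set Implicit Arguments.
Unset Strict Implicit.
Unset Printing Implicit Defensive.

Local Open Scope classical_set_scope.
Local Open Scope ring_scope.
Local Open Scope complex_scope.

(* Functions on the circle R/Z are 1-periodic functions on the real line;
   integrals and essential suprema are taken over the period [0, 1]. *)
Definition periodic1 (R : realType) (u : R -> R[i]) : Prop :=
  forall t : R, u (t + 1) = u t.

Definition lebesgue01 (R : realType) :=
  mrestr (@lebesgue_measure R) (measurable_itv `[0%R, 1%R]%R).

(* Modulus of a complex function, as an extended-real valued function. *)
Definition modulus (R : realType) (u : R -> R[i]) (t : R) : \bar R :=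
  (Normc.normc (u t))%:E.

(* For functions on the circle, Lp_norm p u may be +oo; it is a seminorm on
   representatives, i.e. functions are not identified almost everywhere. *)
Definition Lp_norm (R : realType) (p : \bar R) (u : R -> R[i]) : \bar R :=
  'N[@lebesgue01 R]_p [modulus u].

Definition Lp_circle (R : realType) (p : \bar R) : set (R -> R[i]) :=
  [set u | [/\ periodic1 u,
               measurable_fun setT (fun t => complex.Re (u t)),
               measurable_fun setT (fun t => complex.Im (u t)) &
               (Lp_norm p u < +oo)%E]].

Definition C_norm (R : realType) (u : R -> R[i]) : \bar R :=
  ereal_sup (range (modulus u)).

Definition C_circle (R : realType) : set (R -> R[i]) :=
  [set u : R -> R[i] | periodic1 u /\ continuous (u : R -> (R[i] : numFieldType))].

(* Norm of A as an operator on the (semi)normed space given by the set D of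
   its elements and its (semi)norm N. *)
Definition opnorm (R : realType) (D : set (R -> R[i]))
    (N : (R -> R[i]) -> \bar R) (A : (R -> R[i]) -> R -> R[i]) : \bar R :=
  ereal_sup [set N (A u) | u in [set u | D u /\ (N u <= 1)%E]].

Definition opnorm_root (R : realType) (D : set (R -> R[i]))
    (N : (R -> R[i]) -> \bar R) (A : (R -> R[i]) -> R -> R[i]) (n : nat) :
    \bar R :=
  (opnorm D N (iter n A) `^ (n%:R^-1))%E.

Definition spectral_radius (R : realType) (D : set (R -> R[i]))
    (N : (R -> R[i]) -> \bar R) (A : (R -> R[i]) -> R -> R[i]) : \bar R :=
  limn (opnorm_root D N A).

(* Since |cos (pi x)| is 1-periodic in x, the formula for t in [0, 1) is valid
   for every real t when u is 1-periodic, and defines a 1-periodic function. *)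
Definition transfer (R : realType) (d : nat) (s : R) (u : R -> R[i]) (t : R) :
    R[i] :=
  d%:R^-1 * \sum_(i < d)
    (`|cos (pi * ((t + i%:R) / d%:R))| `^ s)%:C * u ((t + i%:R) / d%:R).

(* Main.v *)
Require Import Defs.
From mathcomp Require Import all_boot all_order all_algebra.
From mathcomp Require Import complex ring lra.
From mathcomp Require Import all_classical all_reals all_analysis.
From mathcomp Require Import measurable_realfun ess_sup_inf.
Import Order.TTheory GRing.Theory Num.Theory.
Import numFieldNormedType.Exports.

Set Implicit Arguments.
Unset Strict Implicit.
Unset Printing Implicit Defensive.

Local Open Scope classical_set_scope.
Local Open Scope ring_scope.

(* The n-th iterate of L_s is u |-> S_N (W_n^s u), where N = d^n,
   W_n(x) = prod_(k < n) |cos (pi d^k x)| and S_N is the average over the N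
   inverse branches of x |-> N x mod 1; S_N preserves integrals over a period.
   Put F = S_N (W_n^(q p')). The norm of L_(q p')^n on C(T) is M = sup F, and
   the norm of L_q^n on L^p is exactly M^(1/p'), for every n: Hoelder's
   inequality on the finite sum gives
     |L_q^n u|^p <= F^(p/p') S_N (|u|^p),
   and the functions u(x) = W_n(x)^(q p'/p) 1_{F > a}(N x) with a < M show that
   this is sharp, since L_q^n u = F 1_{F > a}. As M is submultiplicative in n,
   the n-th roots converge by Fekete's lemma. *)

(** * Invariance of the integral over a period *)

Definition branch_avg (R : realType) (N : nat) (f : R -> R) (t : R) : R :=
  N%:R^-1 * \sum_(j < N) f ((t + j%:R) / N%:R).

(** The restricted measure does not charge the complement of [[0, 1]], and the point 1 is null. The
    half-open period is wanted because its images under the inverse branches are disjoint and cover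
    it exactly. *)
Lemma integral_lebesgue01 (R : realType) (f : R -> \bar R) :
  measurable_fun setT f -> (forall x, (0 <= f x)%E) ->
  (\int[@lebesgue01 R]_x f x = \int[lebesgue_measure]_(x in `[0%R, 1%R[) f x)%E.
Proof.
move=> mf f0.
rewrite (@ge0_negligible_integral _ _ _ _ setT
  (~` (`[0%R, 1%R] : set (measurableTypeR R)))) //; last 2 first.
- by apply: measurableC.
- by rewrite /lebesgue01/= /mrestr setICl measure0.
rewrite setDE setCK setTI (@eq_measure_integral _ _ _ _ (@lebesgue_measure R)); last first.
  by move=> A mA AI; rewrite /= /lebesgue01 /mrestr setIidl.
by rewrite integral_itv_bndo_bndc //; exact: measurable_funTS.
Qed.

(** The image measure scaled by [1 / c] gives every interval []a, b]] its length, so it is Lebesgue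
    measure by uniqueness. *)
Lemma lebesgue_measure_affine (R : realType) (c r : R) (A : set R) : 0 < c ->
  measurable A ->
  lebesgue_measure ((fun t => (t + r) / c) @^-1` A) =
  (c%:E * lebesgue_measure A)%E.
Proof.
move=> c0 mA.
pose phi (t : measurableTypeR R) : measurableTypeR R := (t + r) / c.
have mphi : measurable_fun setT phi.
  have : measurable_fun setT (fun t : R => (t + r) / c).
    by apply: measurable_funM => //; exact: measurable_funD.
  exact.
have ci0 : 0 <= c^-1 by rewrite invr_ge0 ltW.
pose nu : {measure set (measurableTypeR R) -> \bar R} :=
  mscale (NngNum ci0) (pushforward (@lebesgue_measure R) phi).
have nuE : lebesgue_measure A = nu mphi A.
  apply: lebesgue_measure_unique => //= _ [[a b]] _ <-.
  rewrite /nu /= /mscale /= /pushforward.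
  have -> : phi @^-1` `]a, b] = `](a * c - r)%R, (b * c - r)%R]%classic.
    rewrite /phi; apply/seteqP; split => t /=; rewrite !in_itv/= ltr_pdivlMr// ler_pdivrMr//;
      by rewrite ltrBlDr lerBrDr.
  rewrite !lebesgue_measure_itv/= !lte_fin ltrD2r ltr_pM2r//.
  case: ifPn => _; last by rewrite mule0.
  by rewrite -!EFinB -EFinM; congr EFin; field; rewrite gt_eqF.
rewrite nuE /nu /= /mscale /= /pushforward muleA -EFinM mulfV ?gt_eqF// mul1e.
by [].
Qed.

(** The j-th branch maps [[0, 1[] affinely onto [[j / N, (j + 1) / N[]. The change of variables
    produces a factor [N], which cancels the [1 / N] of the average, and the pieces fill the
    period. *)
Lemma integral_branch_avg (R : realType) (N : nat) (f : R -> R) : (0 < N)%N ->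
  measurable_fun setT f -> (forall x, 0 <= f x) ->
  (\int[@lebesgue01 R]_t (branch_avg N f t)%:E = \int[@lebesgue01 R]_t (f t)%:E)%E.
Proof.
move=> N0 mf f0.
have N0' : 0 < N%:R :> R by rewrite ltr0n.
have mphi (r : R) : measurable_fun setT (fun t : R => (t + r) / N%:R).
  by apply: measurable_funM => //; exact: measurable_funD.
have mfj (r : R) : measurable_fun setT (fun t : R => f ((t + r) / N%:R)).
  exact: measurableT_comp.
have mEf (g : R -> R) (D : set R) :
    measurable_fun setT g -> measurable_fun D (EFin \o g).
  by move=> mg; apply: measurable_funTS; exact/measurable_EFinP.
have piece (j : nat) : (\int[lebesgue_measure]_(t in `[0%R, 1%R[)
      (f ((t + j%:R) / N%:R))%:E = N%:R%:E *
    \int[lebesgue_measure]_(x in `[(j%:R / N%:R)%R, (j.+1%:R / N%:R)%R[) (f x)%:E)%E.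
  pose phi (t : measurableTypeR R) : measurableTypeR R := (t + j%:R) / N%:R.
  pose D := `[(j%:R / N%:R : R), (j.+1%:R / N%:R : R)[%classic.
  have -> : `[0%R, 1%R[%classic = phi @^-1` D.
    apply/seteqP; split => t; rewrite /phi /D /= !in_itv/= ler_pM2r ?invr_gt0//;
    by rewrite ltr_pM2r ?invr_gt0// lerDr -natr1 [_ + 1]addrC ltrD2r.
  rewrite -(@ge0_integral_pushforward _ _ _ _ _ phi (mphi _) lebesgue_measure D
    (EFin \o f)) //; last 3 first.
  - exact: (@measurable_itv R).
  - exact: mEf.
  - by move=> x _; rewrite lee_fin.
  have N0n : 0 <= N%:R :> R by exact: ltW.
  rewrite (@eq_measure_integral _ _ _ _ (mscale (NngNum N0n) lebesgue_measure)).
    rewrite ge0_integral_mscale//.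
    - exact: (@measurable_itv R).
    - exact: mEf.
    - by move=> x _; rewrite lee_fin.
  - exact: mphi.
  - by move=> ? A mA _; rewrite /= /pushforward /phi lebesgue_measure_affine.
have mavg : measurable_fun setT (branch_avg N f).
  by apply: measurable_funM => //; apply: measurable_sum.
rewrite !integral_lebesgue01; last 4 first.
- exact/measurable_EFinP.
- by move=> x; rewrite lee_fin.
- exact/measurable_EFinP.
- by move=> x; rewrite lee_fin mulr_ge0 ?invr_ge0// sumr_ge0.
have mI : measurable (`[0%R, 1%R[%classic : set (measurableTypeR R)).
  exact: (@measurable_itv R).
under eq_integral do rewrite /branch_avg EFinM -sumEFin.
rewrite ge0_integralZl_EFin//; last 2 first.
- by move=> x _; apply: sume_ge0 => i _; rewrite lee_fin.
- have : measurable_fun (`[0%R, 1%R[%classic : set R)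
      (fun x : R => \sum_(i < N) (f ((x + i%:R) / N%:R))%:E)%E.
    by apply: emeasurable_sum => i; exact: mEf (mfj _).
  exact.
rewrite ge0_integral_sum//; last 2 first.
- by move=> i; exact: (mEf _ _ (mfj i%:R)).
- by move=> i x _; rewrite lee_fin.
under eq_bigr do rewrite piece.
rewrite -ge0_sume_distrr; last first.
  by move=> i _; apply: integral_ge0 => x _; rewrite lee_fin.
rewrite muleA -EFinM mulVf ?gt_eqF// mul1e.
(* Adjacent pieces are glued by induction on their number [n]; [n = N] gives the whole period. *)
have main (n : nat) : (\sum_(i < n)
   \int[lebesgue_measure]_(x in `[((i : nat)%:R / N%:R)%R, (i.+1%:R / N%:R)%R[) (f x)%:E =
   \int[lebesgue_measure]_(x in `[0%R, (n%:R / N%:R)%R[) (f x)%:E)%E.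
  elim: n => [|n IH]; first by rewrite big_ord0 mul0r set_itvco0 integral_set0.
  rewrite big_ord_recr/= IH -ge0_integral_setU//; last 3 first.
  - exact: mEf.
  - by move=> x _; rewrite lee_fin.
  - apply/disj_setPS => x [] /=; rewrite !in_itv/= => /andP[_ h1] /andP[h2 _].
    by move: (lt_le_trans h1 h2); rewrite ltxx.
  congr integral; rewrite -itv_bndbnd_setU//= bnd_simp.
    by rewrite mulr_ge0 ?invr_ge0 // ltW.
  by rewrite ler_pM2r ?invr_gt0// ler_nat.
by rewrite main mulfV ?gt_eqF.
Qed.

(** * Averages over inverse branches and weighted transfer operators *)

(** Young's inequality [conjugate_powR] is summed after [a] and [b] are divided by their norms. If
    one of the norms vanishes, the left side is 0. *)
Lemma sum_hoelder (R : realType) (I : finType) (a b : I -> R) (p q : R) :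
  0 < p -> 0 < q -> p^-1 + q^-1 = 1 ->
  (forall i, 0 <= a i) -> (forall i, 0 <= b i) ->
  \sum_i a i * b i <=
    (\sum_i a i `^ p) `^ p^-1 * (\sum_i b i `^ q) `^ q^-1.
Proof.
move=> p0 q0 pq a0 b0.
have zero (f g : I -> R) r : 0 < r -> \sum_i f i `^ r = 0 ->
    \sum_i f i * g i = 0.
  move=> r0 /eqP; rewrite psumr_eq0 => [/allP f0|i _]; last exact: powR_ge0.
  apply: big1 => i _; have := f0 i (mem_index_enum _).
  by rewrite /= powR_eq0 => /andP[/eqP -> _]; rewrite mul0r.
have rhs0 : 0 <= (\sum_i a i `^ p) `^ p^-1 * (\sum_i b i `^ q) `^ q^-1.
  by rewrite mulr_ge0// powR_ge0.
have [/zero->//|A0] := eqVneq (\sum_i a i `^ p) 0.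
have [/zero B0|B0] := eqVneq (\sum_i b i `^ q) 0.
  by under eq_bigr do rewrite mulrC; rewrite B0.
set A := \sum_i _ in A0 *; set B := \sum_i _ in B0 *.
have Agt0 : 0 < A by rewrite lt_def A0 sumr_ge0// => i _; exact: powR_ge0.
have Bgt0 : 0 < B by rewrite lt_def B0 sumr_ge0// => i _; exact: powR_ge0.
have alp : (A `^ p^-1) `^ p = A by rewrite -powRrM mulVf ?gt_eqF// powRr1// ltW.
have beq : (B `^ q^-1) `^ q = B by rewrite -powRrM mulVf ?gt_eqF// powRr1// ltW.
(* From here on the two norms [alpha] and [beta] are known only through their positivity and their
   powers [A] and [B]. *)
move: (powR_gt0 p^-1 Agt0) (powR_gt0 q^-1 Bgt0) alp beq {rhs0}.
move: (A `^ p^-1) (B `^ q^-1) => alpha beta al0 be0 alp beq.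
have -> : \sum_i a i * b i = alpha * beta * \sum_i (a i / alpha) * (b i / beta).
  rewrite mulr_sumr; apply: eq_bigr => i _.
  by rewrite mulrACA (mulrCA alpha) (mulrCA beta) !mulfV ?gt_eqF// !mulr1.
rewrite -[leRHS]mulr1 ler_pM2l ?mulr_gt0//.
apply: (@le_trans _ _ (\sum_i ((a i / alpha) `^ p / p + (b i / beta) `^ q / q))).
  apply: ler_sum => i _; apply: conjugate_powR => //.
    by rewrite divr_ge0// ltW.
  by rewrite divr_ge0// ltW.
rewrite big_split/= -!mulr_suml.
have nrm (f : I -> R) c r : 0 < c -> (forall i, 0 <= f i) ->
    \sum_i (f i / c) `^ r = (\sum_i f i `^ r) / c `^ r.
  move=> c0 f0; rewrite mulr_suml; apply: eq_bigr => i _.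
  by rewrite powRM ?invr_ge0 ?(ltW c0)// -(powR_inv1 (ltW c0)) powRAC
     powR_inv1// powR_ge0.
by rewrite !nrm// alp beq -/A -/B !mulfV// !mul1r pq.
Qed.

Lemma periodic_natr (R : realType) (T : Type) (f : R -> T) n x :
  (forall x, f (x + 1) = f x) -> f (x + n%:R) = f x.
Proof. by move=> fper; elim: n => [|n IH]; rewrite ?addr0// -natr1 addrA fper. Qed.

Section branch_avg.
Variables (R : realType) (N : nat).
Hypothesis N0 : (0 < N)%N.

Lemma branch_avg_ge0 (f : R -> R) t : (forall x, 0 <= f x) -> 0 <= branch_avg N f t.
Proof. by move=> f0; rewrite mulr_ge0 ?invr_ge0// sumr_ge0. Qed.

Lemma le_branch_avg (f g : R -> R) t :
  (forall x, f x <= g x) -> branch_avg N f t <= branch_avg N g t.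
Proof. by move=> fg; rewrite ler_wpM2l ?invr_ge0// ler_sum. Qed.

Lemma branch_avgZ c (f : R -> R) t :
  branch_avg N (fun x => c * f x) t = c * branch_avg N f t.
Proof. by rewrite /branch_avg -mulr_sumr mulrCA. Qed.

Lemma branch_avg_cst (c t : R) : branch_avg N (fun=> c) t = c.
Proof.
rewrite /branch_avg sumr_const card_ord -[c *+ N]mulr_natl mulrA mulVf ?mul1r//.
by rewrite pnatr_eq0 -lt0n.
Qed.

(** The shift by 1 permutes the branches cyclically: branch [j] becomes branch [j + 1], and the last
    one becomes the first one up to a period of [f]. *)
Lemma branch_avg_periodic (f : R -> R) :
  (forall x, f (x + 1) = f x) ->
  forall x, branch_avg N f (x + 1) = branch_avg N f x.
Proof.
case: N N0 => // n _ fper x; rewrite /branch_avg; congr (_ * _).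
rewrite big_ord_recr big_ord_recl/= addrC; congr (_ + _).
  rewrite addr0 -addrA [1 + _]addrC natr1 mulrDl mulfV ?pnatr_eq0//.
apply: eq_bigr => i _; rewrite /bump/= add1n -[i.+1%:R]natr1.
by rewrite [_%:R + 1]addrC addrA.
Qed.

(** At the branch point [x = (t + j) / N] one has [N x = t + j], so the second factor equals [g t]
    on every branch. *)
Lemma branch_avg_mulnat (f g : R -> R) t : (forall x, g (x + 1) = g x) ->
  branch_avg N (fun x => f x * g (N%:R * x)) t = branch_avg N f t * g t.
Proof.
move=> gper; rewrite /branch_avg -mulrA; congr (_ * _).
rewrite mulr_suml; apply: eq_bigr => j _.
by rewrite mulrCA mulfV ?pnatr_eq0 -?lt0n// mulr1 (periodic_natr _ _ gper).
Qed.

Lemma measurable_branch_avg (f : R -> R) :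
  measurable_fun setT f -> measurable_fun setT (branch_avg N f).
Proof.
move=> mf; apply: measurable_funM => //; apply: measurable_sum => i.
apply: (measurableT_comp mf); apply: measurable_funM => //.
exact: measurable_funD.
Qed.

Lemma continuous_branch_avg (f : R -> R) :
  continuous f -> continuous (branch_avg N f).
Proof.
move=> cf t; apply: cvgM; first exact: cvg_cst.
apply: cvg_big => [|i _]; first exact: add_continuous.
apply: (@continuous_comp _ _ _ (fun t : R => (t + i%:R) / N%:R) f); last exact: cf.
by apply: cvgM; [apply: cvgD; [exact: cvg_id|exact: cvg_cst]|exact: cvg_cst].
Qed.

Lemma branch_avg_hoelder (f g : R -> R) (p q : R) t :
  0 < p -> 0 < q -> p^-1 + q^-1 = 1 ->
  (forall x, 0 <= f x) -> (forall x, 0 <= g x) ->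
  branch_avg N (fun x => f x * g x) t <=
    branch_avg N (fun x => f x `^ p) t `^ p^-1 *
    branch_avg N (fun x => g x `^ q) t `^ q^-1.
Proof.
move=> p0 q0 pq f0 g0.
have Ni0 : 0 <= N%:R^-1 :> R by rewrite invr_ge0.
have s0 (h : R -> R) r : 0 <= \sum_(j < N) h ((t + j%:R) / N%:R) `^ r.
  by rewrite sumr_ge0// => i _; exact: powR_ge0.
(* The normalising factors combine to [N^-1], because the exponents [p^-1] and [q^-1] sum to 1. *)
rewrite /branch_avg !powRM//= mulrACA -powRD ?pq ?powRr1//; last first.
  by rewrite oner_eq0.
by rewrite ler_wpM2l//; apply: sum_hoelder.
Qed.

End branch_avg.

(** This is [S_N (w u)] for complex [u]. General [N] and [w] let one definition cover [L_s] and all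
    its iterates. *)
Definition wtransfer (R : realType) (N : nat) (w : R -> R) (u : R -> R[i]) (t : R) :
    R[i] :=
  N%:R^-1 * \sum_(j < N) (w ((t + j%:R) / N%:R))%:C%C * u ((t + j%:R) / N%:R).

Section normc.
Variable R : realType.
Implicit Types (z : R[i]) (x : R).
Local Notation normc := (@Normc.normc R).

Lemma normc_ge0 z : 0 <= normc z.
Proof. by case: z => a b; rewrite sqrtr_ge0. Qed.

Lemma normc_real x : normc x%:C%C = `|x|.
Proof. by rewrite /= expr0n addr0 sqrtr_sqr. Qed.

Lemma le_normc_sum (I : finType) (z : I -> R[i]) :
  normc (\sum_i z i) <= \sum_i normc (z i).
Proof.
elim/big_ind2: _ => //; first by rewrite Normc.normc0.
by move=> a b c e h1 h2; have := le_trans (le_normcD b e) (lerD h1 h2); exact.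
Qed.

Lemma natrV_complex N : (N%:R^-1 : R[i]) = (N%:R^-1)%:C%C.
Proof. by rewrite fmorphV rmorph_nat. Qed.

Lemma measurable_normc (u : R -> R[i]) :
  measurable_fun setT (fun t => complex.Re (u t)) ->
  measurable_fun setT (fun t => complex.Im (u t)) ->
  measurable_fun setT (fun t => normc (u t)).
Proof.
move=> mr mi.
have -> : (fun t => normc (u t)) =
    (fun t => Num.sqrt (complex.Re (u t) ^+ 2 + complex.Im (u t) ^+ 2)).
  by apply/funext => t; case: (u t).
apply: (@measurableT_comp _ _ _ _ _ _ (@Num.sqrt R)
  _ (fun t => complex.Re (u t) ^+ 2 + complex.Im (u t) ^+ 2)).
  by apply: continuous_measurable_fun; exact: sqrt_continuous.
by apply: measurable_funD; exact: measurable_funX.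
Qed.

End normc.

Section wtransfer.
Variables (R : realType) (N : nat).
Hypothesis N0 : (0 < N)%N.
Local Notation normc := (@Normc.normc R).

Lemma wtransfer_split (w : R -> R) (u : R -> R[i]) t :
  wtransfer N w u t =
  Complex (branch_avg N (fun x => w x * complex.Re (u x)) t)
          (branch_avg N (fun x => w x * complex.Im (u x)) t).
Proof.
rewrite /wtransfer natrV_complex /branch_avg.
elim/big_rec3: _ => [|j x y z _ IH]; first by rewrite !mulr0.
rewrite mulrDr IH !mulrDr; case: (u _) => a b.
by apply/eqP; rewrite eq_complex /=; apply/andP; split; apply/eqP; ring.
Qed.

Lemma wtransfer_real (w f : R -> R) t :
  wtransfer N w (fun x => (f x)%:C%C) t = (branch_avg N (fun x => w x * f x) t)%:C%C.
Proof.
rewrite wtransfer_split /=; congr Complex.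
have -> : (fun x => w x * 0) = (fun=> 0) by apply/funext => x; rewrite mulr0.
by rewrite branch_avg_cst.
Qed.

Lemma normc_wtransfer_le (w : R -> R) (u : R -> R[i]) t : (forall x, 0 <= w x) ->
  normc (wtransfer N w u t) <= branch_avg N (fun x => w x * normc (u x)) t.
Proof.
move=> w0; rewrite /wtransfer natrV_complex Normc.normcM normc_real ger0_norm ?invr_ge0//.
rewrite ler_wpM2l ?invr_ge0//; apply: (le_trans (le_normc_sum _)).
by apply: ler_sum => j _; rewrite Normc.normcM normc_real ger0_norm.
Qed.

Lemma measurable_normc_wtransfer (w : R -> R) (u : R -> R[i]) :
  measurable_fun setT w ->
  measurable_fun setT (fun t => complex.Re (u t)) ->
  measurable_fun setT (fun t => complex.Im (u t)) ->
  measurable_fun setT (fun t => normc (wtransfer N w u t)).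
Proof.
move=> mw mr mi; apply: measurable_normc.
  under eq_fun do rewrite wtransfer_split /=.
  by apply: measurable_branch_avg; exact: measurable_funM.
under eq_fun do rewrite wtransfer_split /=.
by apply: measurable_branch_avg; exact: measurable_funM.
Qed.

(** Since the weight is nonnegative, the triangle inequality gives the upper bound and the constant
    function 1 attains it. *)
Lemma opnorm_C_wtransfer (w : R -> R) : (forall x, 0 <= w x) ->
  opnorm (@C_circle R) (@C_norm R) (wtransfer N w) =
  ereal_sup (range (EFin \o branch_avg N w)).
Proof.
move=> w0; apply/eqP; rewrite eq_le; apply/andP; split.
  apply: ge_ereal_sup => _ [u [_ u1] <-]; apply: ge_ereal_sup => _ [t _ <-].
  apply: (@le_trans _ _ (branch_avg N w t)%:E); last first.
    by apply: ereal_sup_ubound; exists t.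
  rewrite lee_fin; apply: (le_trans (normc_wtransfer_le _ _ w0)).
  apply: le_branch_avg => x; rewrite ler_piMr// -lee_fin.
  by apply: le_trans u1; apply: ereal_sup_ubound; exists x.
apply: (@le_trans _ _ (C_norm (wtransfer N w (fun x => 1%:C%C)))).
  apply: ge_ereal_sup => _ [t _ <-].
  apply: (@le_trans _ _ (modulus (wtransfer N w (fun x => 1%:C%C)) t)).
    rewrite /modulus wtransfer_real normc_real lee_fin /=.
    by rewrite (_ : (fun x => w x * 1) = w) ?ler_norm//; apply/funext => x; rewrite mulr1.
  by apply: ereal_sup_ubound; exists t.
apply: ereal_sup_ubound; exists (fun x => 1%:C%C) => //; split.
  by split => // x; exact: cvg_cst.
apply: ge_ereal_sup => _ [t _ <-].
by rewrite /modulus normc_real normr1.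
Qed.

End wtransfer.

(** * Operator norms on L^p and C *)

Lemma continuous_powR (R : realType) (f : R -> R) (p : R) : 0 < p ->
  (forall x, 0 <= f x) -> continuous f -> continuous (fun x => f x `^ p).
Proof.
move=> p0 f0 cf x.
have [fx0|fx0] := eqVneq (f x) 0; last first.
  apply: (@continuous_comp _ _ _ f (fun y => y `^ p)); first exact: cf.
  have fxp : 0 < f x by rewrite lt_def fx0 f0.
  apply: differentiable_continuous; apply/derivable1_diffP.
  by have [] := is_derive1_powR p fxp.
(* At a zero of [f] the power need not be differentiable; the tolerance [e] is met as soon as
   [f y < e ^ (1 / p)]. *)
rewrite /continuous_at fx0 powR0 ?gt_eqF//; apply/cvgr0Pnorm_lt => e e0.
have d0 : 0 < e `^ p^-1 by exact: powR_gt0.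
have := cf x; rewrite /continuous_at fx0 => /cvgr0Pnorm_lt/(_ _ d0).
apply: filterS => y; rewrite !ger0_norm ?powR_ge0// => h.
have -> : e = (e `^ p^-1) `^ p.
  by rewrite -powRrM mulVf ?gt_eqF// powRr1// ltW.
by rewrite gt0_ltr_powR// nnegrE ?powR_ge0.
Qed.

Lemma lebesgue01_setT (R : realType) : lebesgue01 [set: measurableTypeR R] = 1%E.
Proof.
by rewrite /lebesgue01 /mrestr setTI lebesgue_measure_itv/= lte_fin ltr01 -EFinB subr0.
Qed.

(** Periodicity moves [t] to its fractional part [s] in [[0, 1[]; by continuity the set then
    contains a nonempty interval to the right of [s] inside [[0, 1]]. *)
Lemma lebesgue01_superlevel_gt0 (R : realType) (f : R -> R) (a t : R) :
  continuous f -> (forall x, f (x + 1) = f x) -> a < f t ->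
  (0 < @lebesgue01 R [set x : R | (a < f x)%R])%E.
Proof.
move=> cf fper aft.
have fint (m : int) x : f (x + m%:~R) = f x.
  case: m => n; first exact: periodic_natr.
  by rewrite NegzE mulrNz -[LHS](periodic_natr n.+1 _ fper) subrK.
have [s /andP[s0 s1] afs] : exists2 s, 0 <= s < 1 & a < f s.
  exists (t - (Num.floor t)%:~R).
    by rewrite subr_ge0 floor_le/= ltrBlDl; have := floorD1_gt t; rewrite intrD.
  by rewrite -mulrNz fint.
have /nbhs_ballP[e /= e0 be] : nbhs s [set x | a < f x].
  by have := cf s; move=> /cvgr_gt; apply.
pose b := Num.min 1 (s + e).
have sb : s < b by rewrite lt_min s1 ltrDl.
apply: (@lt_le_trans _ _ (lebesgue_measure (`]s, b[%classic : set (measurableTypeR R)))).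
  by rewrite lebesgue_measure_itv/= lte_fin sb -EFinB lte_fin subr_gt0.
rewrite /lebesgue01 /mrestr; apply: le_measure.
- by rewrite inE; exact: (@measurable_itv R).
- rewrite inE; apply: measurableI; last exact: (@measurable_itv R).
  have mf : measurable_fun setT f by exact: continuous_measurable_fun.
  have := mf measurableT `]a, +oo[%classic (measurable_itv _).
  rewrite setTI; congr measurable.
  by apply/seteqP; split => x /=; rewrite in_itv/= andbT.
move=> x /=; rewrite !in_itv/= lt_min => /andP[sx /andP[x1 xe]]; split.
  apply: be; rewrite /ball/= ltr0_norm ?subr_lt0// opprB ltrBlDl//.
by rewrite (ltW x1) (le_trans s0 (ltW sx)).
Qed.

Lemma lebesgue01_negligible (R : realType) (A : set R) : measurable A ->
  (@lebesgue01 R).-negligible A -> @lebesgue01 R A = 0%E.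
Proof.
move=> mA; have mA' : measurable (A : set (measurableTypeR R)) by [].
by move/(negligibleP _ mA').
Qed.

Section Lp_norm.
Variable R : realType.
Local Notation normc := (@Normc.normc R).

Lemma Lp_normE (r : R) (u : R -> R[i]) :
  Lp_norm r%:E u = ((\int[@lebesgue01 R]_t (normc (u t) `^ r)%:E) `^ r^-1)%E.
Proof.
rewrite /Lp_norm unlock.
by under eq_integral do rewrite /modulus /= ger0_norm ?normc_ge0//.
Qed.

Lemma Lp_normyE (u : R -> R[i]) :
  Lp_norm +oo%E u = ess_sup (@lebesgue01 R) (modulus u).
Proof.
(* The norm with exponent [+oo] unfolds to an essential supremum only if the whole space has
   positive measure; here it has measure 1. *)
rewrite /Lp_norm unlock [X in (_ < X)%E]lebesgue01_setT lte01; congr ess_sup.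
by apply/funext => t; rewrite /modulus /= ger0_norm// normc_ge0.
Qed.

End Lp_norm.

Section integral01.
Variable R : realType.
Implicit Types f g : R -> R.

Lemma measurable_EFin01 f : measurable_fun setT f ->
  measurable_fun [set: measurableTypeR R] (EFin \o f).
Proof. by move=> mf; have : measurable_fun setT (EFin \o f) by exact/measurable_EFinP. Qed.

Lemma le_integral01 f g : measurable_fun setT f -> measurable_fun setT g ->
  (forall x, 0 <= f x) -> (forall x, f x <= g x) ->
  (\int[@lebesgue01 R]_t (f t)%:E <= \int[@lebesgue01 R]_t (g t)%:E)%E.
Proof.
move=> mf mg f0 fg; apply: ge0_le_integral => //.
- by move=> x _; rewrite lee_fin.
- exact: measurable_EFin01.
- exact: measurable_EFin01.
- by move=> x _; rewrite lee_fin.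
Qed.

Lemma integral01Z (c : R) f : measurable_fun setT f ->
  0 <= c -> (forall x, 0 <= f x) ->
  (\int[@lebesgue01 R]_t (c * f t)%:E = c%:E * \int[@lebesgue01 R]_t (f t)%:E)%E.
Proof.
move=> mf c0 f0; under eq_integral do rewrite EFinM.
rewrite ge0_integralZl_EFin//; first by move=> x _; rewrite lee_fin.
exact: measurable_EFin01.
Qed.

Lemma integral01_indic (A : set R) : measurable A ->
  (\int[@lebesgue01 R]_t (\1_A t)%:E = lebesgue01 A)%E.
Proof.
move=> mA; have mA' : measurable (A : set (measurableTypeR R)) by [].
by rewrite (integral_indic _ measurableT mA') setIT.
Qed.

Lemma integral01_cst (c : R) : (\int[@lebesgue01 R]_t c%:E = c%:E)%E.
Proof. by rewrite integral_cst//= [X in (_ * X)%E]lebesgue01_setT mule1. Qed.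

End integral01.

Lemma Lp_norm_real (R : realType) (r : R) (f : R -> R) : (forall t, 0 <= f t) ->
  Lp_norm r%:E (fun t => (f t)%:C%C) =
    ((\int[@lebesgue01 R]_t (f t `^ r)%:E) `^ r^-1)%E.
Proof.
move=> f0; rewrite Lp_normE.
by under eq_integral do rewrite normc_real ger0_norm//.
Qed.

Lemma integral_Lp_le1 (R : realType) (r : R) (u : R -> R[i]) : 0 < r ->
  (Lp_norm r%:E u <= 1)%E ->
  (\int[@lebesgue01 R]_t (Normc.normc (u t) `^ r)%:E <= 1)%E.
Proof.
move=> r0; rewrite Lp_normE => I1.
have I0 : (0 <= \int[@lebesgue01 R]_t (Normc.normc (u t) `^ r)%:E)%E.
  by apply: integral_ge0 => t _; rewrite lee_fin powR_ge0.
rewrite -[leLHS]poweRe1// -[X in (_ `^ X)%E](mulVf (lt0r_neq0 r0)) poweRrM -[leRHS](poweR1r r).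
by apply: gt0_ler_poweR => //; rewrite ?(ltW r0)// in_itv/= ?lee01 ?leey ?poweR_ge0.
Qed.

(** Left continuity of the power at [M], for a bound [X] that may be infinite: if [X < M ^ r], the
    midpoint of [X ^ (1 / r)] and [M] contradicts the assumption. *)
Lemma powR_lee_left_lim (R : realType) (M r : R) (X : \bar R) : 0 < M -> 0 < r ->
  (forall a : R, 0 < a -> a < M -> ((a `^ r)%:E <= X)%E) -> ((M `^ r)%:E <= X)%E.
Proof.
move=> M0 r0 leX; rewrite leNgt; apply/negP => XM.
(* One admissible value of [a] rules out [X = -oo] and makes [X] nonnegative, so that its root can
   be taken. *)
have hX : (((M / 2) `^ r)%:E <= X)%E by apply: leX; lra.
case: X leX XM hX => [x| |] //= leX; rewrite lte_fin lee_fin => xM hx.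
have x0 : 0 <= x by apply: le_trans hx; exact: powR_ge0.
have xr : (x `^ r^-1) `^ r = x by rewrite -powRrM mulVf ?lt0r_neq0// powRr1.
have bM : x `^ r^-1 < M.
  rewrite ltNge; apply/negP => h; move: xM; rewrite -xr ltNge => /negP; apply.
  by rewrite ge0_ler_powR ?nnegrE ?powR_ge0 ?(ltW M0) ?(ltW r0).
pose a := (x `^ r^-1 + M) / 2.
have b0 : 0 <= x `^ r^-1 by exact: powR_ge0.
have ba : x `^ r^-1 < a by rewrite /a; lra.
have aM : a < M by rewrite /a; lra.
have a0 : 0 < a by exact: le_lt_trans ba.
have := leX a a0 aM; rewrite lee_fin leNgt => /negP; apply.
by rewrite -{1}xr gt0_ltr_powR ?nnegrE ?(ltW a0).
Qed.

(** * The exact norm of a weighted transfer operator on L^p *)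

Section Lp_opnorm.
Variables (R : realType) (N : nat) (v : R -> R).
Hypothesis N0 : (0 < N)%N.
Hypothesis v_cont : continuous v.
Hypothesis v_per : forall x, v (x + 1) = v x.
Hypothesis v_ge0 : forall x, 0 <= v x.
Hypothesis v_le1 : forall x, v x <= 1.
Variables (q : R).
Hypothesis q1 : 1 <= q.
Let q0 : 0 < q. Proof. exact: lt_le_trans q1. Qed.
(** In this section [q] is the exponent conjugate to that of the space, and not the power of the
    cosine. With [v] equal to that power of [W_n], these are the [F] and [M] of the overview. *)
Let F := branch_avg N (fun x => v x `^ q).
Let M := sup (range F).

Let F_ge0 t : 0 <= F t.
Proof. by apply: branch_avg_ge0 => // x; exact: powR_ge0. Qed.

Let F_le1 t : F t <= 1.
Proof.
rewrite -(branch_avg_cst N0 1 t); apply: le_branch_avg => // x.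
apply: (@le_trans _ _ (1 `^ q)); last by rewrite powR1.
by rewrite ge0_ler_powR// ?nnegrE// ltW.
Qed.

Let F_cont : continuous F.
Proof. by apply: continuous_branch_avg => //; exact: continuous_powR. Qed.

Let F_per x : F (x + 1) = F x.
Proof. by apply: branch_avg_periodic => // y; rewrite v_per. Qed.

Let v_meas : measurable_fun setT v.
Proof. exact: continuous_measurable_fun. Qed.

Let F_meas : measurable_fun setT F.
Proof. exact: continuous_measurable_fun. Qed.

Let F_sup t : F t <= M.
Proof. by apply: sup_upper_bound; [split; [exists (F 0), 0|exists 1 => _ [x _ <-]]|exists t]. Qed.

Let M_ge0 : 0 <= M. Proof. exact: le_trans (F_ge0 0) (F_sup 0). Qed.

Let level (a : R) := [set x : R | a < F x].

Let level_meas a : measurable (level a).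
Proof.
rewrite (_ : level a = F @^-1` `]a, +oo[); last first.
  by apply/seteqP; split => x /=; rewrite in_itv/= andbT.
by rewrite -[_ @^-1` _]setTI; apply: F_meas.
Qed.

Let level_gt0 a : a < M -> (0 < @lebesgue01 R (level a))%E.
Proof.
move=> /sup_gt[|_ [t _ <-] aFt]; first by exists (F 0), 0.
exact: lebesgue01_superlevel_gt0 aFt.
Qed.

Lemma opnorm_Lp_le (p : R) : 0 < p -> p^-1 + q^-1 = 1 ->
  (opnorm (Lp_circle p%:E) (Lp_norm p%:E) (wtransfer N v) <= (M `^ q^-1)%:E)%E.
Proof.
move=> p0 pq; apply: ge_ereal_sup => _ [u [[_ mr mi _] u1] <-].
have {}u1 := integral_Lp_le1 p0 u1.
have mn := measurable_normc mr mi.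
have mnp : measurable_fun setT (fun t => Normc.normc (u t) `^ p).
  exact: (measurableT_comp (measurable_powR p)).
(* The p-th power of the claimed bound: the comparison is made between integrals of p-th powers. *)
pose c := (M `^ q^-1) `^ p.
rewrite Lp_normE (_ : (M `^ q^-1)%:E = (c%:E `^ p^-1)%E); last first.
  by rewrite poweR_EFin -powRrM mulfV ?lt0r_neq0// powRr1// powR_ge0.
apply: gt0_ler_poweR; rewrite ?invr_ge0 ?(ltW p0)//.
- rewrite in_itv/= leey andbT; apply: integral_ge0 => t _.
  by rewrite lee_fin powR_ge0.
- by rewrite in_itv/= leey andbT lee_fin powR_ge0.
apply: (@le_trans _ _ (\int[@lebesgue01 R]_t
    (c * branch_avg N (fun x => Normc.normc (u x) `^ p) t)%:E)%E).
  apply: le_integral01.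
  - have mA := measurable_normc_wtransfer N v_meas mr mi.
    exact: (measurableT_comp (measurable_powR p) mA).
  - by apply: measurable_funM => //; exact: measurable_branch_avg.
  - by move=> t; exact: powR_ge0.
  - move=> t; rewrite {}/c.
    have avg0 : 0 <= branch_avg N (fun x => Normc.normc (u x) `^ p) t.
      by apply: branch_avg_ge0 => // x; exact: powR_ge0.
    (* The average is written as the p-th power of its p-th root, so that both sides are p-th powers
       and Hoelder's inequality applies to the bases. *)
    rewrite -[X in _ * X]powRr1// -(mulVf (lt0r_neq0 p0)) [X in _ * X]powRrM.
    rewrite -powRM ?powR_ge0// ge0_ler_powR ?nnegrE ?(ltW p0) ?mulr_ge0 ?powR_ge0 ?normc_ge0//.
    apply: (le_trans (normc_wtransfer_le N u t v_ge0)).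
    have qp : q^-1 + p^-1 = 1 by rewrite addrC.
    have un0 x : 0 <= Normc.normc (u x) by exact: normc_ge0.
    apply: (le_trans (branch_avg_hoelder N t q0 p0 qp v_ge0 un0)).
    rewrite ler_wpM2r ?powR_ge0// ge0_ler_powR ?nnegrE ?invr_ge0 ?(ltW q0)//.
rewrite integral01Z ?powR_ge0//; last 2 first.
- exact: measurable_branch_avg.
- by move=> x; apply: branch_avg_ge0 => // y; exact: powR_ge0.
rewrite integral_branch_avg//; last by move=> x; exact: powR_ge0.
by rewrite -[leRHS]mule1 lee_wpmul2l// lee_fin powR_ge0.
Qed.

(** For the normalised test function, the p-th power of the norm of the image is the ratio of the
    integrals of [F ^ p] and [F] over the set [F > a]. There [F ^ p >= a ^ (p - 1) * F], so the
    ratio is at least [a ^ (p - 1)]. *)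
Lemma opnorm_Lp_ge (p a : R) : 0 < p -> p^-1 + q^-1 = 1 -> 0 < a -> a < M ->
  ((a `^ q^-1)%:E <= opnorm (Lp_circle p%:E) (Lp_norm p%:E) (wtransfer N v))%E.
Proof.
move=> p0 pq a0 aM.
pose ind : R -> R := \1_(level a).
have ind01 x : 0 <= ind x <= 1.
  by rewrite /ind indicE; case: (_ \in _); rewrite /= ?lexx ?ler01.
have ind0 x : 0 <= ind x by case/andP: (ind01 x).
have indX x : ind x `^ p = ind x.
  rewrite /ind indicE; case: (_ \in _); first by rewrite powR1.
  by rewrite powR0// gt_eqF.
have ind_per x : ind (x + 1) = ind x.
  have level_per : (x + 1 \in level a) = (x \in level a).
    by apply/idP/idP; rewrite !inE /level/= F_per.
  by rewrite /ind !indicE level_per.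
have mind : measurable_fun setT ind by exact: measurable_indic.
have mF1 : measurable_fun setT (fun t => F t * ind t) by exact: measurable_funM.
have F10 t : 0 <= F t * ind t by rewrite mulr_ge0.
have aF1 t : a * ind t <= F t * ind t.
  rewrite /ind indicE; have [|_] := boolP (t \in level a); last by rewrite !mulr0.
  by rewrite inE !mulr1 => /ltW.
pose I := (\int[@lebesgue01 R]_t (F t * ind t)%:E)%E.
have I1 : (I <= 1)%E.
  rewrite -(integral01_cst (1 : R)); apply: le_integral01 => // x.
  by rewrite mulr_ile1//; case/andP: (ind01 x).
(* [I] will divide: the integrand is at least [a] on the level set, which has positive measure
   because [a < M]. *)
have I0 : (0 < I)%E.
  apply: (@lt_le_trans _ _ (a%:E * lebesgue01 (level a))%E).
    by rewrite mule_gt0// level_gt0.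
  rewrite -integral01_indic// -(integral01Z mind (ltW a0) ind0).
  apply: le_integral01 => //; first by apply: measurable_funM.
  by move=> x; rewrite mulr_ge0// ltW.
have Ifin : I \is a fin_num.
  by rewrite ge0_fin_numE ?ltW// (le_lt_trans I1) ?ltry.
pose K := fine I.
have IK : I = K%:E by rewrite fineK.
have K0 : 0 < K by rewrite -lte_fin -IK.
(* Before normalisation the test function has norm [K ^ (1 / p)], since [S_N] turns its p-th power
   into [F * ind]. *)
pose c := K `^ (- p^-1).
have c0 : 0 <= c by exact: powR_ge0.
have cp : c `^ p = K^-1.
  by rewrite -powRrM mulNr mulVf ?lt0r_neq0// powR_inv1// ltW.
pose f x := c * (v x `^ (q / p) * ind (N%:R * x)).
have f0 x : 0 <= f x by rewrite !mulr_ge0// powR_ge0.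
have mNx : measurable_fun setT (fun x : R => N%:R * x) by exact: measurable_funM.
have mv r : measurable_fun setT (fun x => v x `^ r).
  exact: (measurableT_comp (measurable_powR r) v_meas).
have mindN : measurable_fun setT (fun x : R => ind (N%:R * x)).
  exact: (measurableT_comp mind mNx).
have mf : measurable_fun setT f.
  by apply: measurable_funM => //; exact: measurable_funM.
have fp x : f x `^ p = K^-1 * (v x `^ q * ind (N%:R * x)).
  rewrite /f !powRM ?mulr_ge0 ?powR_ge0// cp indX -powRrM.
  by rewrite -mulrA mulVf ?mulr1// lt0r_neq0.
have normf : Lp_norm p%:E (fun x => (f x)%:C%C) = 1%E.
  rewrite Lp_norm_real//; under eq_integral do rewrite fp.
  rewrite integral01Z ?invr_ge0 ?(ltW K0)//; last 2 first.
  - exact: measurable_funM.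
  - by move=> x; rewrite mulr_ge0 ?powR_ge0.
  rewrite -(integral_branch_avg N0); last 2 first.
  - exact: measurable_funM.
  - by move=> x; rewrite mulr_ge0 ?powR_ge0.
  under eq_integral do rewrite branch_avg_mulnat//.
  by rewrite -/F -/I IK -EFinM mulVf ?lt0r_neq0// poweR1r.
apply: (@le_trans _ _ (Lp_norm p%:E (wtransfer N v (fun x => (f x)%:C%C)))); last first.
  apply: ereal_sup_ubound; exists (fun x => (f x)%:C%C); rewrite //=; split.
    split => //=; last by rewrite normf ltry.
    move=> x; congr (_%:C%C); rewrite /f v_per mulrDr mulr1; congr (_ * (_ * _)).
    exact: periodic_natr ind_per.
  by rewrite normf.
have wf : wtransfer N v (fun x => (f x)%:C%C) = fun t => (c * (F t * ind t))%:C%C.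
  apply/funext => t; rewrite wtransfer_real//; congr (_%:C%C).
  rewrite (_ : (fun x => v x * f x) =
      (fun x => c * (v x `^ q * ind (N%:R * x)))); last first.
    apply/funext => x; rewrite /f mulrCA; congr (_ * _); rewrite mulrA.
    (* The powers of [v] add up to [1 + q / p = q] by conjugacy. *)
    congr (_ * _); rewrite -[X in X * _]powRr1// -powRD.
      congr (_ `^ _); have : q * (p^-1 + q^-1) = q by rewrite pq mulr1.
      by rewrite mulrDr mulfV ?lt0r_neq0// addrC.
    by rewrite gt_eqF// ltr_wpDr// divr_ge0// ltW.
  by rewrite branch_avgZ branch_avg_mulnat.
rewrite wf Lp_norm_real; last by move=> t; rewrite mulr_ge0.
(* Conjugacy again: [(p - 1) / p = 1 / q]. *)
rewrite (_ : a `^ q^-1 = (a `^ (p - 1)) `^ p^-1); last first.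
  rewrite -powRrM mulrBl mulfV ?lt0r_neq0// mul1r -pq; congr (_ `^ _); ring.
rewrite -poweR_EFin; apply: gt0_ler_poweR; rewrite ?invr_ge0 ?(ltW p0)//.
- by rewrite in_itv/= leey andbT lee_fin powR_ge0.
- rewrite in_itv/= leey andbT; apply: integral_ge0 => t _.
  by rewrite lee_fin powR_ge0.
have mB : measurable_fun setT (fun t => K^-1 * (F t * ind t)) by exact: measurable_funM.
apply: (@le_trans _ _ (\int[@lebesgue01 R]_t
    ((a `^ (p - 1)) * (K^-1 * (F t * ind t)))%:E)%E).
  rewrite integral01Z ?powR_ge0//; last by move=> x; rewrite mulr_ge0// invr_ge0 ltW.
  rewrite integral01Z ?invr_ge0 ?(ltW K0)//.
  by rewrite -/I IK -!EFinM mulVf ?lt0r_neq0// mulr1.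
apply: le_integral01.
- by apply: measurable_funM.
- apply: (measurableT_comp (measurable_powR p)).
  by apply: measurable_funM.
- by move=> x; rewrite mulr_ge0 ?powR_ge0// mulr_ge0// invr_ge0 ltW.
move=> t; rewrite (powRM p c0 (F10 t)) (powRM p (F_ge0 t) (ind0 t)) cp indX.
rewrite mulrCA ler_wpM2l ?invr_ge0 ?(ltW K0)//.
rewrite /ind indicE; have [|_] := boolP (t \in level a); last by rewrite !mulr0.
rewrite inE !mulr1 => /= aF.
have Ft0 : 0 < F t by exact: lt_trans aF.
have p1 : 0 <= p - 1.
  rewrite subr_ge0 -[leRHS]invrK -[leLHS]invr1 lef_pV2 ?posrE ?invr_gt0//.
  by rewrite -pq lerDl invr_ge0 ltW.
rewrite -(mulr_powRB1 (ltW Ft0) p0) mulrC ler_wpM2l// ge0_ler_powR ?nnegrE ?(ltW a0) ?(ltW aF)//.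
Qed.

Lemma opnorm_Lp (p : R) : 0 < p -> p^-1 + q^-1 = 1 -> 0 < M ->
  opnorm (Lp_circle p%:E) (Lp_norm p%:E) (wtransfer N v) = (M `^ q^-1)%:E.
Proof.
move=> p0 pq M0; apply/eqP; rewrite eq_le opnorm_Lp_le//=.
apply: powR_lee_left_lim => //; first by rewrite invr_gt0.
by move=> a a0 aM; exact: opnorm_Lp_ge.
Qed.

(** The bound [|u| <= 1] holds only off a null set [B]. The average of the indicator of [B] has
    integral 0, so for almost every [t] no branch point lies in [B], and there the pointwise
    estimate applies. *)
Lemma opnorm_Ly_le : q = 1 ->
  (opnorm (Lp_circle +oo%E) (Lp_norm +oo%E) (wtransfer N v) <= M%:E)%E.
Proof.
move=> q_1; apply: ge_ereal_sup => _ [u [[_ mr mi _] u1] <-].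
have mn := measurable_normc mr mi.
pose B := [set x : R | 1 < Normc.normc (u x)].
have mB : measurable B.
  rewrite (_ : B = (fun x => Normc.normc (u x)) @^-1` `]1, +oo[); last first.
    by apply/seteqP; split => x /=; rewrite in_itv/= andbT.
  by rewrite -[_ @^-1` _]setTI; apply: mn.
have B0 : @lebesgue01 R B = 0%E.
  rewrite Lp_normyE in u1; move/ess_supP : u1 => h.
  apply: lebesgue01_negligible => //; apply: negligibleS h => x.
  by rewrite /B /= /modulus lee_fin ltNge => /negP.
pose ind : R -> R := \1_B.
have ind0 x : 0 <= ind x by rewrite /ind indicE.
have mind : measurable_fun setT ind by exact: measurable_indic.
have mA : measurable_fun setT (branch_avg N ind) by exact: measurable_branch_avg.
have : (\int[@lebesgue01 R]_t `|(branch_avg N ind t)%:E| = 0)%E.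
  under eq_integral do rewrite gee0_abs ?lee_fin ?branch_avg_ge0//.
  by rewrite integral_branch_avg// integral01_indic.
move=> /(ae_eq_integral_abs _ measurableT (measurable_EFin01 mA)) h.
rewrite Lp_normyE; apply/ess_supP; apply: filterS h => t /(_ I)/= [avg0].
rewrite lee_fin; apply: (le_trans (normc_wtransfer_le N u t v_ge0)).
apply: le_trans (F_sup t); rewrite /F /branch_avg ler_wpM2l ?invr_ge0//.
apply: ler_sum => j _; rewrite q_1 powRr1// ler_piMr// leNgt; apply/negP => yB.
(* A vanishing average of nonnegative terms has only zero terms, whereas the j-th branch point would
   contribute 1. *)
move/eqP : avg0; rewrite mulf_eq0 invr_eq0 pnatr_eq0 gtn_eqF//= psumr_eq0//.
move=> /allP/(_ j (mem_index_enum _)); rewrite /= /ind indicE mem_set//.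
by rewrite oner_eq0.
Qed.

(** The constant function 1 is mapped to [F]. An essential supremum below [a] would make the set
    [F > a] null, against [level_gt0]. *)
Lemma opnorm_Ly_ge (a : R) : q = 1 -> a < M ->
  (a%:E <= opnorm (Lp_circle +oo%E) (Lp_norm +oo%E) (wtransfer N v))%E.
Proof.
move=> q_1 aM.
have n1 : (Lp_norm +oo%E (fun _ : R => 1%:C%C) <= 1)%E.
  by rewrite Lp_normyE; apply/ess_supP; apply: nearW => t; rewrite /modulus normc_real normr1.
apply: (@le_trans _ _ (Lp_norm +oo%E (wtransfer N v (fun=> 1%:C%C)))); last first.
  apply: ereal_sup_ubound; exists (fun=> 1%:C%C) => //; split => //; split => //.
  by rewrite (le_lt_trans n1) ?ltry.
rewrite Lp_normyE leNgt; apply/negP => lta.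
have /ess_supP h := lexx (ess_sup (@lebesgue01 R) (modulus (wtransfer N v (fun=> 1%:C%C)))).
have := level_gt0 aM; rewrite lt_neqAle eq_sym => /andP[/eqP + _]; apply.
apply: lebesgue01_negligible => //.
apply: negligibleS h => t; rewrite /level /= => aF.
rewrite /modulus wtransfer_real// normc_real ger0_norm; last first.
  by apply: branch_avg_ge0 => // x; rewrite mulr1.
move=> le; have := le_lt_trans le lta; rewrite lte_fin ltNge => /negP; apply.
apply: (le_trans (ltW aF)); apply: le_branch_avg => // x.
by rewrite q_1 powRr1// mulr1.
Qed.

Lemma opnorm_Ly : q = 1 -> 0 < M ->
  opnorm (Lp_circle +oo%E) (Lp_norm +oo%E) (wtransfer N v) = M%:E.
Proof.
move=> q_1 M0; apply/eqP; rewrite eq_le opnorm_Ly_le//= -[M]powRr1 ?(ltW M0)//.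
apply: powR_lee_left_lim => // a a0 aM; rewrite powRr1 ?(ltW a0)//.
exact: opnorm_Ly_ge.
Qed.

Lemma opnorm_C :
  opnorm (@C_circle R) (@C_norm R) (wtransfer N (fun x => v x `^ q)) = M%:E.
Proof.
rewrite opnorm_C_wtransfer//; last by move=> x; exact: powR_ge0.
rewrite -ereal_sup_EFin.
- by congr ereal_sup; rewrite image_comp.
- by exists 1 => _ [x _ <-].
- by exists (F 0), 0.
Qed.

End Lp_opnorm.

(** * Fekete's lemma *)

(** The limit is the infimum of [u n / n] over [n >= 1], finite by the linear lower bound. Division
    with remainder, [n = k m + r], gives [u n <= k * u m], where [u r] is dropped because it is at
    most 0. *)
Lemma cvg_subadditive_div (R : realType) (u : nat -> R) (C : R) :
  (forall m n, u (m + n)%N <= u m + u n) ->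
  (forall n, u n <= 0) -> (forall n, - (C * n%:R) <= u n) ->
  cvgn (fun n => n%:R^-1 * u n).
Proof.
move=> usub u0 uC.
have umul m k r : u (k * m + r)%N <= k%:R * u m.
  elim: k => [|k IH]; first by rewrite mul0r mul0n add0n.
  rewrite mulSn -addnA (le_trans (usub _ _))// -natr1 mulrDl mul1r addrC.
  by rewrite lerD2r.
pose E := [set (n.+1%:R^-1 * u n.+1) | n in [set: nat]].
have infE : has_inf E.
  split; first by exists (1%:R^-1 * u 1%N), 0%N.
  exists (- C) => _ [n _ <-].
  by rewrite mulrC ler_pdivlMr ?ltr0n// mulNr.
apply/cvg_ex; exists (inf E); apply/cvgrPdist_le => e e0.
have e2 : 0 < e / 2 by rewrite divr_gt0.
(* The divisor [m.+1] is chosen with quotient within [e / 2] of the infimum; the other half of [e]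
   pays for the remainder. *)
have [_ [m _ <-] um] := inf_adherent e2 infE.
near=> n.
have n0 : (0 < n)%N by near: n; exact: nbhs_infty_gt.
have n0' : 0 < n%:R :> R by rewrite ltr0n.
have Ln : inf E <= n%:R^-1 * u n.
  by apply: ge_inf; [case: infE|exists n.-1 => //; rewrite prednK].
rewrite distrC ger0_norm ?subr_ge0// lerBlDl.
have m0 : 0 < m.+1%:R :> R by rewrite ltr0n.
pose a := u m.+1; pose k := (n %/ m.+1)%N.
have uk : u n <= k%:R * a by rewrite {1}(divn_eq n m.+1); exact: umul.
have kn : n%:R <= k%:R * m.+1%:R + m.+1%:R :> R.
  by rewrite -natrM -natrD ler_nat {1}(divn_eq n m.+1) leq_add2l ltnW// ltn_mod.
(* As [a <= 0], the bound [k >= n / m.+1 - 1] from [kn] turns into an upper bound for [k * a]; the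
   error [- a / n] tends to 0. *)
have bnd : n%:R^-1 * u n <= m.+1%:R^-1 * a - n%:R^-1 * a.
  rewrite -(ler_pM2l n0') mulrA mulfV ?lt0r_neq0// mul1r mulrBr.
  rewrite !mulrA mulfV ?lt0r_neq0// mul1r (le_trans uk)//.
  rewrite -[X in _ - X]mul1r -mulrBl ler_wnM2r ?u0// lerBlDr ler_pdivrMr//.
  by rewrite mulrDl mul1r.
apply: (le_trans bnd); rewrite (splitr e) addrA; apply: lerD; first exact: ltW.
rewrite -mulrN mulrC ler_pdivrMr// mulrC -ler_pdivrMr//.
by near: n; exact: nbhs_infty_ger.
Unshelve. all: by end_near. Qed.

(** Fekete's lemma for [ln (x n)], where [c ^+ n <= x n] supplies the linear lower bound. The limit
    is an exponential, hence positive, and real powers are continuous there. *)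
Lemma cvg_submultiplicative_root (R : realType) (x : nat -> R) (c : R) :
  0 < c -> (forall n, c ^+ n <= x n) -> (forall n, x n <= 1) ->
  (forall m n, x (m + n)%N <= x m * x n) ->
  exists2 l : R, 0 < l & (fun n => x n `^ n%:R^-1) @ \oo --> l.
Proof.
move=> c0 cx x1 xM.
have x0 n : 0 < x n by apply: lt_le_trans (cx n); exact: exprn_gt0.
have /cvg_ex[l ul] : cvgn (fun n => n%:R^-1 * ln (x n)).
  apply: (@cvg_subadditive_div _ _ (- ln c)) => [m n|n|n].
  - by rewrite -lnM ?posrE// ler_ln ?posrE// mulr_gt0.
  - exact: ln_le0.
  - by rewrite mulNr opprK mulr_natr -lnXn// ler_ln ?posrE// exprn_gt0.
exists (expR l); first exact: expR_gt0.
rewrite (_ : (fun n => _) = expR \o (fun n => n%:R^-1 * ln (x n))).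
  by apply: continuous_cvg => //; exact: continuous_expR.
by apply/funext => n /=; rewrite /powR gt_eqF.
Qed.

(** * Iterates of the transfer operator *)

Lemma sum_ord_mul (V : zmodType) (f : nat -> V) (a b : nat) :
  \sum_(m < a * b) f m = \sum_(k < a) \sum_(i < b) f (i + b * k)%N.
Proof.
elim: a => [|a IH]; first by rewrite mul0n !big_ord0.
rewrite big_ord_recr/= -IH mulSnr big_split_ord/=; congr (_ + _).
by apply: eq_bigr => i _; rewrite addnC mulnC.
Qed.

Lemma normr_cosD_natpi (R : realType) (x : R) n : `|cos (x + pi * n%:R)| = `|cos x|.
Proof.
elim: n => [|n IH]; first by rewrite mulr0 addr0.
by rewrite -natr1 mulrDr mulr1 addrA cosDpi normrN.
Qed.

(** Branch [k] of the inner operator after branch [i] of the outer one is branch [m = i + N k] of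
    the composite, at the point [y m]. As [N' * y m = (t + i) / N + k], periodicity of [w] removes
    [k]. *)
Lemma wtransfer_comp (R : realType) (N N' : nat) (w w' : R -> R) (u : R -> R[i]) :
  (0 < N)%N -> (0 < N')%N -> (forall x, w (x + 1) = w x) ->
  wtransfer N w (wtransfer N' w' u) =
  wtransfer (N' * N) (fun x => w' x * w (N'%:R * x)) u.
Proof.
move=> N0 N'0 wper; apply/funext => t; rewrite /wtransfer.
have n0 : N%:R != 0 :> R by rewrite pnatr_eq0 -lt0n.
have n'0 : N'%:R != 0 :> R by rewrite pnatr_eq0 -lt0n.
pose y m : R := (t + m%:R) / (N' * N)%:R.
rewrite (sum_ord_mul (fun m => (w' (y m) * w (N'%:R * y m))%:C%C * u (y m))).
rewrite exchange_big/= natrM invfM [N'%:R^-1 * _]mulrC -mulrA; congr (_ * _).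
rewrite mulr_sumr; apply: eq_bigr => i _.
rewrite mulrCA; congr (_ * _); rewrite mulr_sumr; apply: eq_bigr => k _.
have yE : y (i + N * k)%N = ((t + i%:R) / N%:R + k%:R) / N'%:R.
  by rewrite /y !natrM natrD natrM invfM; field; apply/andP.
have -> : w (N'%:R * y (i + N * k)%N) = w ((t + i%:R) / N%:R).
  by rewrite yE mulrCA mulfV// mulr1 periodic_natr.
by rewrite yE mulrA [w' _ * _]mulrC rmorphM.
Qed.

Lemma transferE (R : realType) (d : nat) (s : R) :
  transfer d s = wtransfer d (fun x => `|cos (pi * x)| `^ s).
Proof. by []. Qed.

Section cos_product.
Variables (R : realType) (d : nat).
Hypothesis d2 : (2 <= d)%N.

Definition cos_product (n : nat) (x : R) : R :=
  \prod_(k < n) `|cos (pi * ((d ^ k)%:R * x))|.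

Let d0 : (0 < d)%N. Proof. exact: ltnW. Qed.

Lemma cos_product_ge0 n x : 0 <= cos_product n x.
Proof. by apply: prodr_ge0 => k _. Qed.

Lemma cos_product_le1 n x : cos_product n x <= 1.
Proof.
apply: prodr_ile1 => k _; rewrite normr_ge0/= ler_norml cos_le1 andbT.
exact: cos_geN1.
Qed.

Lemma cos_product0 n : cos_product n 0 = 1.
Proof. by apply: big1 => k _; rewrite !mulr0 cos0 normr1. Qed.

Lemma cos_product_periodic n x : cos_product n (x + 1) = cos_product n x.
Proof.
apply: eq_bigr => k _.
by rewrite mulrDr mulr1 mulrDr normr_cosD_natpi.
Qed.

Lemma continuous_cos_product n : continuous (cos_product n).
Proof.
move=> x; rewrite /cos_product; apply: cvg_big => [|k _]; first exact: mul_continuous.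
apply: cvg_norm; apply: continuous_comp; last exact: continuous_cos.
by apply: cvgM; [exact: cvg_cst|apply: cvgM; [exact: cvg_cst|exact: cvg_id]].
Qed.

(** One more application on the outside multiplies the weight by the one-step weight evaluated at
    [d^n x], which is the next factor of [W_n]. *)
Lemma iter_transfer n (s : R) (u : R -> R[i]) :
  iter n (transfer d s) u = wtransfer (d ^ n) (fun x => cos_product n x `^ s) u.
Proof.
elim: n => [|n IH].
  apply/funext => t; rewrite /wtransfer expn0 invr1 mul1r big_ord1.
  by rewrite /cos_product big_ord0 powR1 mul1r addr0 divr1.
rewrite iterS IH transferE wtransfer_comp ?expn_gt0 ?d0//; last first.
  by move=> x; rewrite mulrDr mulr1 cosDpi normrN.
rewrite -expnSr; congr wtransfer; apply/funext => x.
by rewrite /cos_product big_ord_recr/= powRM// cos_product_ge0.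
Qed.

(** The number [M] of the overview as a sequence of reals in [n]; [opnorm_C_iter] identifies it with
    a norm on C(T) for [s = q * p']. *)
Definition norm_C (s : R) (n : nat) : R :=
  sup (range (branch_avg (d ^ n) (fun x => cos_product n x `^ s))).

Section s.
Variable (s : R).
Hypothesis s0 : 0 < s.

Let F n := branch_avg (d ^ n) (fun x => cos_product n x `^ s).

Let dn0 n : (0 < d ^ n)%N. Proof. by rewrite expn_gt0 d0. Qed.

Let F_ge0 n t : 0 <= F n t.
Proof. by apply: branch_avg_ge0 => x; exact: powR_ge0. Qed.

Let F_le1 n t : F n t <= 1.
Proof.
rewrite -(branch_avg_cst (dn0 n) 1 t); apply: le_branch_avg => x.
apply: (@le_trans _ _ (1 `^ s)); last by rewrite powR1.
by rewrite ge0_ler_powR ?nnegrE ?cos_product_ge0 ?cos_product_le1// ltW.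
Qed.

Lemma branch_avg_le_norm_C n t : F n t <= norm_C s n.
Proof.
apply: sup_upper_bound; last by exists t.
split; first by exists (F n 0), 0.
by exists 1 => _ [x _ <-]; exact: F_le1.
Qed.

Lemma norm_C_le (n : nat) (c : R) : (forall t, F n t <= c) -> norm_C s n <= c.
Proof. move=> h; apply: ge_sup; first by exists (F n 0), 0.
by move=> _ [t _ <-]; exact: h. Qed.

(** At [t = 0] the branch [j = 0] stays at 0, where [W_n] equals 1; this single term contributes
    [d^-n]. *)
Lemma norm_C_ge_expr n : (d%:R^-1) ^+ n <= norm_C s n.
Proof.
apply: le_trans (branch_avg_le_norm_C n 0); rewrite /F /branch_avg exprVn natrX.
rewrite -[leLHS]mulr1 ler_wpM2l ?invr_ge0 ?exprn_ge0//.
rewrite (bigD1 (Ordinal (dn0 n)))//= addr0 mul0r cos_product0 powR1 lerDl.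
by apply: sumr_ge0 => i _; exact: powR_ge0.
Qed.

(** [F (m + n)] is the m-th iterate applied to [F n], and [F n] is bounded by the constant
    [norm_C s n]. *)
Lemma norm_C_submul m n : norm_C s (m + n) <= norm_C s m * norm_C s n.
Proof.
apply: norm_C_le => t.
have -> : F (m + n)%N t = branch_avg (d ^ m) (fun x => cos_product m x `^ s * F n x) t.
  (* The cocycle identity is read off from the iterates of the constant function 1. *)
  have : iter (m + n) (transfer d s) (fun=> 1%:C%C) t =
      iter m (transfer d s) (iter n (transfer d s) (fun=> 1%:C%C)) t by rewrite iterD.
  rewrite !iter_transfer wtransfer_real//.
  rewrite (_ : wtransfer (d ^ n) _ _ = (fun x => (F n x)%:C%C)); last first.
    apply/funext => x; rewrite wtransfer_real//; congr (_%:C%C).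
    by congr branch_avg; apply/funext => z; rewrite mulr1.
  rewrite wtransfer_real// => -[<-]; congr branch_avg.
  by apply/funext => z; rewrite mulr1.
apply: (@le_trans _ _ (branch_avg (d ^ m) (fun x => norm_C s n * cos_product m x `^ s) t)).
  by apply: le_branch_avg => x; rewrite mulrC ler_wpM2r ?powR_ge0// branch_avg_le_norm_C.
rewrite branch_avgZ mulrC ler_wpM2r ?branch_avg_le_norm_C//.
exact: le_trans (F_ge0 n 0) (branch_avg_le_norm_C n 0).
Qed.

Lemma norm_C_gt0 n : 0 < norm_C s n.
Proof.
by apply: lt_le_trans (norm_C_ge_expr n); rewrite exprn_gt0// invr_gt0 ltr0n.
Qed.

Lemma cvg_norm_C_root :
  exists2 l : R, 0 < l & (fun n => norm_C s n `^ n%:R^-1) @ \oo --> l.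
Proof.
apply: (@cvg_submultiplicative_root _ _ d%:R^-1).
- by rewrite invr_gt0 ltr0n.
- exact: norm_C_ge_expr.
- by move=> n; exact: norm_C_le.
- exact: norm_C_submul.
Qed.

End s.

Section opnorm_iter.
Variables (q p' : R).
Hypothesis q0 : 0 < q.
Hypothesis p'1 : 1 <= p'.

Let dn0 n : (0 < d ^ n)%N. Proof. by rewrite expn_gt0 d0. Qed.
(** The weight to which the norm computations above are applied, with [p'] as the conjugate
    exponent; its power [p'] is [W_n ^ (q p')]. *)
Let v n (x : R) := cos_product n x `^ q.

Let v_cont n : continuous (v n).
Proof.
apply: continuous_powR => //; last exact: continuous_cos_product.
exact: cos_product_ge0.
Qed.

Let v_per n x : v n (x + 1) = v n x.
Proof. by rewrite /v cos_product_periodic. Qed.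

Let v_ge0 n x : 0 <= v n x. Proof. exact: powR_ge0. Qed.

Let v_le1 n x : v n x <= 1.
Proof.
apply: (@le_trans _ _ (1 `^ q)); last by rewrite powR1.
by rewrite ge0_ler_powR ?nnegrE ?cos_product_ge0 ?cos_product_le1// ltW.
Qed.

Let vE n : (fun x => v n x `^ p') = (fun x => cos_product n x `^ (q * p')).
Proof. by apply/funext => x; rewrite powRrM. Qed.

Let M_gt0 n : 0 < norm_C (q * p') n.
Proof. by apply: norm_C_gt0; rewrite mulr_gt0// (lt_le_trans _ p'1). Qed.

Let iterE n s : iter n (transfer d s) = wtransfer (d ^ n) (fun x => cos_product n x `^ s).
Proof. by apply/funext => u; rewrite iter_transfer. Qed.

Lemma opnorm_C_iter n :
  opnorm (@C_circle R) (@C_norm R) (iter n (transfer d (q * p'))) =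
  (norm_C (q * p') n)%:E.
Proof.
rewrite iterE -vE.
rewrite (opnorm_C (dn0 n) (@v_ge0 n) (@v_le1 n) p'1).
by rewrite vE.
Qed.

Lemma opnorm_Lp_iter (p : R) n : 0 < p -> p^-1 + p'^-1 = 1 ->
  opnorm (Lp_circle p%:E) (Lp_norm p%:E) (iter n (transfer d q)) =
  (norm_C (q * p') n `^ p'^-1)%:E.
Proof.
move=> p0 pp'; rewrite iterE.
rewrite (opnorm_Lp (dn0 n) (@v_cont n) (@v_per n) (@v_ge0 n) (@v_le1 n) p'1 p0 pp') vE//.
exact: M_gt0.
Qed.

Lemma opnorm_Ly_iter n : p' = 1 ->
  opnorm (@Lp_circle R +oo%E) (@Lp_norm R +oo%E) (iter n (transfer d q)) =
  (norm_C (q * p') n `^ p'^-1)%:E.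
Proof.
move=> p'_1; rewrite iterE.
rewrite (opnorm_Ly (dn0 n) (@v_cont n) (@v_per n) (@v_ge0 n) (@v_le1 n) p'1 p'_1) vE.
  by rewrite p'_1 invr1 powRr1// -p'_1 ltW// M_gt0.
exact: M_gt0.
Qed.

End opnorm_iter.
End cos_product.

(** * Convergence of the roots and comparison of the spectral radii *)

Lemma cvgn_powR (R : realType) (x : nat -> R) (l r : R) : 0 < l ->
  x @ \oo --> l -> (fun n => x n `^ r) @ \oo --> l `^ r.
Proof.
move=> l0 xl; apply: (@continuous_cvg _ _ _ _ _ x (fun y => y `^ r)) => //.
apply: differentiable_continuous; apply/derivable1_diffP.
by have [] := is_derive1_powR r l0.
Qed.

Theorem proposition5p1 (R : realType) (d : nat) (q : R) (p : \bar R)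
    (hd : (2 <= d)%N) (hq : 0 < q) (hp : (1 < p)%E) :
  let p' := fine (hoelder_conjugate p) in
  [/\ cvgn (opnorm_root (Lp_circle p) (Lp_norm p) (transfer d q)),
      cvgn (opnorm_root (@C_circle R) (@C_norm R) (transfer d (q * p'))) &
      spectral_radius (Lp_circle p) (Lp_norm p) (transfer d q) =
      (spectral_radius (@C_circle R) (@C_norm R) (transfer d (q * p'))
         `^ (p'^-1))%E].
Proof.
move=> p'.
(* The two ranges of [p] meet in one exact formula: [p' = r / (r - 1)] for finite [p = r], and
   [p' = 1] for [p = +oo]. *)
have [p'1 Lp] : 1 <= p' /\ forall n,
    opnorm (Lp_circle p) (Lp_norm p) (iter n (transfer d q)) =
    (norm_C d (q * p') n `^ p'^-1)%:E.
  rewrite /p'; case: p hp {p'} => [r| |]//; last first.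
    by move=> _; split; rewrite /hoelder_conjugate/= // => n; exact: opnorm_Ly_iter.
  rewrite lte_fin => r1.
  have r0 : 0 < r by exact: lt_trans r1.
  have r10 : 0 < r - 1 by rewrite subr_gt0.
  have -> : fine (hoelder_conjugate r%:E) = r / (r - 1).
    by rewrite /hoelder_conjugate/= eqe gt_eqF// inver gt_eqF.
  have r'1 : 1 <= r / (r - 1) by rewrite ler_pdivlMr// mul1r gerBl.
  split => // n; apply: opnorm_Lp_iter => //.
  by field; rewrite !gt_eqF.
have s0 : 0 < q * p' by rewrite mulr_gt0// (lt_le_trans _ p'1).
have [l l0 cl] := cvg_norm_C_root hd s0.
have rootC : opnorm_root (@C_circle R) (@C_norm R) (transfer d (q * p')) =
    EFin \o (fun n => norm_C d (q * p') n `^ n%:R^-1).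
  by apply/funext => n; rewrite /opnorm_root opnorm_C_iter.
(* The n-th root and the power [1 / p'] commute, so the L^p roots are a fixed power of the roots on
   C(T), and [l > 0] allows passing to the limit. *)
have rootL : opnorm_root (Lp_circle p) (Lp_norm p) (transfer d q) =
    EFin \o (fun n => (norm_C d (q * p') n `^ n%:R^-1) `^ p'^-1).
  by apply/funext => n; rewrite /opnorm_root Lp poweR_EFin /=; congr EFin; exact: powRAC.
have cvgC : opnorm_root (@C_circle R) (@C_norm R) (transfer d (q * p')) @ \oo --> l%:E.
  by rewrite rootC; apply: cvg_EFin => //; exact: nearW.
have cvgL : opnorm_root (Lp_circle p) (Lp_norm p) (transfer d q) @ \oo --> (l `^ p'^-1)%:E.
  by rewrite rootL; apply: cvg_EFin; [exact: nearW|exact: cvgn_powR].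
split; [by apply/cvg_ex; eexists; exact: cvgL|by apply/cvg_ex; eexists; exact: cvgC|].
by rewrite /spectral_radius (cvg_lim _ cvgL)// (cvg_lim _ cvgC).
Qed.
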